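(* Consider a $\mathcal{C}^1$ system of the form $$\dot x=y=P(x,y),\qquad \dot y=h_0(x)+h_1(x)y+h_2(x)y^2+y^3=Q(x,y),$$ and fix a positive integer $n$. There is a constructive procedure to obtain an $(n+1)$-th order linear differential equation $$y^{(n+1)}(x)+r_{n,n}(x)\,y^{(n)}(x)+\cdots+r_{n,1}(x)\,y'(x)+r_{n,0}(x)\,y(x)=0,$$ such that if $y(x)=v_n(x)$ is any of its solutions, we can define a function $$V_n(x,y):=v_{n,0}(x)+v_{n,1}(x)y+v_{n,2}(x)y^2+\cdots+v_{n,n}(x)y^n,$$ where $v_{n,n}(x)=v_n(x)$ and $v_{n,i}(x)$, $i=0,\ldots,n-1$, are obtained from given expressions involving $h_0(x),h_1(x),h_2(x)$, $v_n(x)$ and their derivatives, such that the function $$M^{[n]}:=\langle\nabla V_n,(P,Q)\rangle-\frac n3V_n\operatorname{div}(P,Q)$$ is a function only of the $x$-variable.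
   Context: Here $\operatorname{div}(P,Q)=\frac{\partial P}{\partial x}+\frac{\partial Q}{\partial y}$ and $\langle\cdot,\cdot\rangle$ is the scalar product in $\mathbb{R}^2$.
   Formalization: Besides the C^1 assumption on the system, the formal theorem assumes h_2 is C^n, h_1 is C^(n-1) and h_0 is C^(n-2) (truncated at 0), so that the derivatives in the linear equation exist; for n≥2 bare C^1 is not enough. *)

(* Defs.v *)
From Stdlib Require Import Reals QArith Qreals.
From Coquelicot Require Import Coquelicot.
Open Scope R_scope.

Definition in_itv (a b : Rbar) (x : R) : Prop := Rbar_lt a x /\ Rbar_lt x b.

Definition class_C (k : nat) (I : R -> Prop) (f : R -> R) : Prop :=
  forall x, I x -> forall j, (j <= k)%nat ->
    ex_derive_n f j x /\ continuous (Derive_n f j) x.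

(* Class C^1 on the strip I x R. *)
Definition class_C1_2d (I : R -> Prop) (F : R -> R -> R) : Prop :=
  forall x y, I x ->
    ex_derive (fun t => F t y) x /\
    ex_derive (fun t => F x t) y /\
    continuity_2d_pt (fun u w => Derive (fun t => F t w) u) x y /\
    continuity_2d_pt (fun u w => Derive (fun t => F u t) w) x y.

Definition Pfield (x y : R) : R := y.

Definition Qfield (h0 h1 h2 : R -> R) (x y : R) : R :=
  h0 x + h1 x * y + h2 x * y ^ 2 + y ^ 3.

Definition grad (F : R -> R -> R) (x y : R) : R * R :=
  (Derive (fun t => F t y) x, Derive (fun t => F x t) y).

Definition dot (u w : R * R) : R := fst u * fst w + snd u * snd w.

Definition divergence (P Q : R -> R -> R) (x y : R) : R :=
  Derive (fun t => P t y) x + Derive (fun t => Q x t) y.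

Definition Mfun (n : nat) (P Q V : R -> R -> R) (x y : R) : R :=
  dot (grad V x y) (P x y, Q x y) - INR n / 3 * V x y * divergence P Q x y.

(* Differential polynomials with rational coefficients in unknown functions
   indexed by A; [dder a k] stands for the k-th derivative of the function a.
   They are the formal expressions produced by the procedure. *)
Inductive dexpr (A : Type) : Type :=
| dcst : Q -> dexpr A
| dder : A -> nat -> dexpr A
| dadd : dexpr A -> dexpr A -> dexpr A
| dmul : dexpr A -> dexpr A -> dexpr A.

Arguments dcst {A} _.
Arguments dder {A} _ _.
Arguments dadd {A} _ _.
Arguments dmul {A} _ _.

Fixpoint dval {A : Type} (env : A -> R -> R) (e : dexpr A) (x : R) : R :=
  match e with
  | dcst q => Q2R q
  | dder a k => Derive_n (env a) k x
  | dadd e1 e2 => dval env e1 x + dval env e2 x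
  | dmul e1 e2 => dval env e1 x * dval env e2 x
  end.

(* Since [Derive_n] is total, this is what makes [dval] meaningful: an
   expression may only mention derivatives that are known to exist. *)
Fixpoint orders_le {A : Type} (N : A -> nat) (e : dexpr A) : Prop :=
  match e with
  | dcst _ => True
  | dder a k => (k <= N a)%nat
  | dadd e1 e2 | dmul e1 e2 => orders_le N e1 /\ orders_le N e2
  end.

Inductive coef : Type := H0 | H1 | H2.

Definition henv (h0 h1 h2 : R -> R) (j : coef) : R -> R :=
  match j with H0 => h0 | H1 => h1 | H2 => h2 end.

(* [None] is the solution v_n. *)
Definition hvenv (h0 h1 h2 v : R -> R) (j : option coef) : R -> R :=
  match j with Some j => henv h0 h1 h2 j | None => v end.

(* The highest derivatives of h_0, h_1, h_2 entering the (n+1)-th order equation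
   (truncated subtraction). *)
Definition horder (n : nat) (j : coef) : nat :=
  match j with H0 => n - 2 | H1 => n - 1 | H2 => n end.

Definition hvorder (n : nat) (j : option coef) : nat :=
  match j with Some j => horder n j | None => S n end.

(* v is a solution on I of
   y^(n+1) + r_n y^(n) + ... + r_1 y' + r_0 y = 0. *)
Definition lin_ode_solution (n : nat) (I : R -> Prop) (r : nat -> R -> R)
    (v : R -> R) : Prop :=
  forall x, I x ->
    (forall k, (k <= S n)%nat -> ex_derive_n v k x) /\
    Derive_n v (S n) x + sum_f_R0 (fun i => r i x * Derive_n v i x) n = 0.

Definition Vpoly (n : nat) (c : nat -> R -> R) (x y : R) : R :=
  sum_f_R0 (fun i => c i x * y ^ i) n.

(* Main.v *)
(** Matching the powers [y^(n+1), ..., y^1] in [M^[n]] (the power [y^(n+2)]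
    cancels) gives, with [u_j := v_(n-j)],
      [(j+1) u_(j+1) = u_j' + (n+2-j) h0 u_(j-2) + (n+1-j-n/3) h1 u_(j-1)
                       + (n-j-2n/3) h2 u_j],   [0 <= j <= n].
    Starting from [u_0 = v] this defines [u_1, ..., u_n], and the last equation
    says that the quantity [u_(n+1)] it produces has to vanish.  Each [u_j] is a
    linear differential operator of order [j] applied to [v], with leading
    coefficient [1/j!], so [(n+1)! u_(n+1) = 0] is the required monic equation. *)

Require Import Defs.
From Stdlib Require Import Reals QArith Qreals Arith Lra Lia.
From Coquelicot Require Import Coquelicot.
Open Scope R_scope.

(** * Formal calculus of differential polynomials *)

(** Differentiating formally keeps [u_j'] an expression that depends on [n] and [j] only, before any
    function is chosen. *)
Fixpoint dderiv {A : Type} (e : dexpr A) : dexpr A :=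
  match e with
  | dcst _ => dcst 0
  | dder a k => dder a (S k)
  | dadd e1 e2 => dadd (dderiv e1) (dderiv e2)
  | dmul e1 e2 => dadd (dmul (dderiv e1) e2) (dmul e1 (dderiv e2))
  end.

(** Used with [Some], to view an expression in the [h_i] as one in the [h_i] and [v]. *)
Fixpoint dmap {A B : Type} (f : A -> B) (e : dexpr A) : dexpr B :=
  match e with
  | dcst q => dcst q
  | dder a k => dder (f a) k
  | dadd e1 e2 => dadd (dmap f e1) (dmap f e2)
  | dmul e1 e2 => dmul (dmap f e1) (dmap f e2)
  end.

Fixpoint dsum {A : Type} (f : nat -> dexpr A) (m : nat) : dexpr A :=
  match m with
  | O => f O
  | S m' => dadd (dsum f m') (f m)
  end.

(** Each factor of a product is bounded separately, not the total weight. This is enough to control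
    the orders of the derivatives, and products then preserve the bound. *)
Fixpoint weight_le {A : Type} (wt : A -> nat) (m : nat) (e : dexpr A) : Prop :=
  match e with
  | dcst _ => True
  | dder a k => (wt a + k <= m)%nat
  | dadd e1 e2 | dmul e1 e2 => weight_le wt m e1 /\ weight_le wt m e2
  end.

Lemma weight_le_mono {A : Type} (wt : A -> nat) (m m' : nat) (e : dexpr A) :
  (m <= m')%nat -> weight_le wt m e -> weight_le wt m' e.
Proof.
  intros Hm; induction e; simpl; auto; [lia | tauto | tauto].
Qed.

Lemma weight_le_dderiv {A : Type} (wt : A -> nat) (m : nat) (e : dexpr A) :
  weight_le wt m e -> weight_le wt (S m) (dderiv e).
Proof.
  induction e; simpl; auto; [lia | tauto |].
  intros [H1 H2]; repeat split; auto;
    apply weight_le_mono with m; auto.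
Qed.

Lemma weight_le_dmap {A B : Type} (f : A -> B) (wt : B -> nat) (m : nat)
    (e : dexpr A) :
  weight_le (fun a => wt (f a)) m e -> weight_le wt m (dmap f e).
Proof. induction e; simpl; tauto. Qed.

Lemma weight_le_dsum {A : Type} (wt : A -> nat) (k : nat) (f : nat -> dexpr A)
    (m : nat) :
  (forall i, (i <= m)%nat -> weight_le wt k (f i)) -> weight_le wt k (dsum f m).
Proof. induction m; simpl; auto. Qed.

Lemma weight_le_orders {A : Type} (wt N : A -> nat) (m : nat) (e : dexpr A) :
  (forall a k, (wt a + k <= m)%nat -> (k <= N a)%nat) ->
  weight_le wt m e -> orders_le N e.
Proof. intros H; induction e; simpl; auto; tauto. Qed.

Lemma dval_dmap {A B : Type} (f : A -> B) (env : B -> R -> R) (e : dexpr A)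
    (x : R) :
  dval env (dmap f e) x = dval (fun a => env (f a)) e x.
Proof. induction e; simpl; congruence. Qed.

Lemma dderiv_dmap {A B : Type} (f : A -> B) (e : dexpr A) :
  dderiv (dmap f e) = dmap f (dderiv e).
Proof. induction e; simpl; congruence. Qed.

Lemma dval_dsum {A : Type} (env : A -> R -> R) (f : nat -> dexpr A) (m : nat)
    (x : R) :
  dval env (dsum f m) x = sum_f_R0 (fun i => dval env (f i) x) m.
Proof. induction m; simpl; congruence. Qed.

Lemma dderiv_dsum {A : Type} (f : nat -> dexpr A) (m : nat) :
  dderiv (dsum f m) = dsum (fun i => dderiv (f i)) m.
Proof. induction m; simpl; congruence. Qed.

Lemma is_derive_dval {A : Type} (env : A -> R -> R) (wt : A -> nat) (m : nat)
    (e : dexpr A) (x : R) :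
  (forall a k, (wt a + k <= m)%nat -> ex_derive_n (env a) (S k) x) ->
  weight_le wt m e -> is_derive (dval env e) x (dval env (dderiv e) x).
Proof.
  intros H; induction e as [q | a k | e1 IH1 e2 IH2 | e1 IH1 e2 IH2]; simpl.
  - intros _. rewrite RMicromega.Q2R_0. apply (is_derive_const (V := R_NormedModule)).
  - intros Hk. apply Derive_correct, H, Hk.
  - intros [W1 W2]. apply (is_derive_plus (V := R_NormedModule)); auto.
  - intros [W1 W2].
    apply (is_derive_mult (dval env e1) (dval env e2)); auto.
    exact Rmult_comm.
Qed.

Lemma continuous_dval {A : Type} (env : A -> R -> R) (wt : A -> nat) (m : nat)
    (e : dexpr A) (x : R) :
  (forall a k, (wt a + k <= m)%nat -> continuous (Derive_n (env a) k) x) ->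
  weight_le wt m e -> continuous (dval env e) x.
Proof.
  intros H; induction e as [q | a k | e1 IH1 e2 IH2 | e1 IH1 e2 IH2]; simpl.
  - intros _. apply continuous_const.
  - intros Hk. apply H, Hk.
  - intros [W1 W2]. apply (continuous_plus (V := R_NormedModule)); auto.
  - intros [W1 W2]. apply (continuous_mult (K := R_AbsRing)); auto.
Qed.

(** * Finite sums and open intervals *)

Lemma continuous_sum_f_R0 (f : nat -> R -> R) (m : nat) (x : R) :
  (forall i, (i <= m)%nat -> continuous (f i) x) ->
  continuous (fun t => sum_f_R0 (fun i => f i t) m) x.
Proof.
  induction m as [|m IH]; simpl; intros H; auto.
  apply (continuous_plus (V := R_NormedModule)); auto.
Qed.

Lemma is_derive_sum_f_R0 (f : nat -> R -> R) (d : nat -> R) (m : nat) (x : R) :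
  (forall i, (i <= m)%nat -> is_derive (f i) x (d i)) ->
  is_derive (fun t => sum_f_R0 (fun i => f i t) m) x (sum_f_R0 d m).
Proof.
  induction m as [|m IH]; simpl; intros H; auto.
  apply (is_derive_plus (V := R_NormedModule)); auto.
Qed.

Lemma sum_f_R0_support (f : nat -> R) (m N : nat) :
  (forall i, (m < i)%nat -> f i = 0) -> (m <= N)%nat ->
  sum_f_R0 f N = sum_f_R0 f m.
Proof.
  intros Hf; induction 1 as [|N HN IH]; auto.
  simpl; rewrite IH, Hf; [ring | lia].
Qed.

(** With [g i] the derivative [v^(i)], this reindexes the terms in [v^(i+1)] that arise when [v^(i)]
    is differentiated. *)
Lemma sum_f_R0_shift (f g : nat -> R) (m : nat) :
  sum_f_R0 (fun i => match i with O => 0 | S i' => f i' end * g i) (S m) =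
  sum_f_R0 (fun i => f i * g (S i)) m.
Proof.
  induction m as [|m IH]; [simpl; ring |].
  rewrite tech5, IH. reflexivity.
Qed.

Lemma in_itv_locally (a b : Rbar) (x : R) :
  in_itv a b x -> locally x (in_itv a b).
Proof.
  intros [Ha Hb]. apply filter_and; [now apply open_Rbar_gt | now apply open_Rbar_lt].
Qed.

(** * Coefficients of the operators that give [u_j] *)

(* With these weights (and weight 0 for [v], each derivative adding 1), every
   monomial of [u_j] has weight at most [j]: this bounds all the orders at once. *)
Definition cwt (j : coef) : nat :=
  match j with H0 => 3 | H1 => 2 | H2 => 1 end.

Definition ocwt (j : option coef) : nat :=
  match j with Some j => cwt j | None => 0 end.

(* Coefficient of [v^(i)] in [u_j].  The guard makes it syntactically zero for
   [i > j], so that its formal derivative vanishes as well. *)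
Fixpoint opcoef (n j i : nat) : dexpr coef :=
  match j with
  | O => match i with O => dcst 1 | S _ => dcst 0 end
  | S j1 =>
    if (j <? i)%nat then dcst 0 else
    dmul (dcst (1 # Pos.of_succ_nat j1))
      (dadd
        (dadd (dderiv (opcoef n j1 i))
              match i with O => dcst 0 | S i1 => opcoef n j1 i1 end)
        (dadd
          (dmul (dmul (dcst (Z.of_nat n - 3 * Z.of_nat j1 # 3)) (dder H2 0))
                (opcoef n j1 i))
          match j1 with
          | O => dcst 0
          | S j2 =>
            dadd
              (dmul (dmul (dcst (2 * Z.of_nat n + 3 - 3 * Z.of_nat j1 # 3))
                          (dder H1 0))
                    (opcoef n j2 i))
              match j2 with
              | O => dcst 0
              | S j3 =>
                dmul (dmul (dcst (Z.of_nat n + 2 - Z.of_nat j1 # 1))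
                           (dder H0 0))
                     (opcoef n j3 i)
              end
          end))
  end.

Lemma opcoef_gt (n j i : nat) : (j < i)%nat -> opcoef n j i = dcst 0.
Proof.
  destruct j as [|j]; intros Hi; [now destruct i; [lia |] |].
  cbn [opcoef]. now rewrite (proj2 (Nat.ltb_lt _ _) Hi).
Qed.

(** Strong induction, since the recursion reaches back three indices. The weights 1, 2, 3 of [h_2],
    [h_1], [h_0] are the indices [j] at which they first enter, and a formal derivative costs
    one. *)
Lemma weight_le_opcoef (n j i : nat) : weight_le cwt j (opcoef n j i).
Proof.
  revert i; induction j as [j IH] using lt_wf_ind; intros i.
  assert (IHm : forall k i', (k < j)%nat -> weight_le cwt j (opcoef n k i')).
  { intros k i' Hk. apply weight_le_mono with k; [lia | now apply IH]. }
  destruct j as [|j]; [destruct i; exact I |].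
  cbn [opcoef]. destruct (S j <? i)%nat; [exact I |].
  cbn [weight_le cwt]. repeat split; try lia; auto.
  - apply weight_le_dderiv, IH; lia.
  - destruct i; [exact I | auto].
  - destruct j as [|j]; [exact I |].
    cbn [weight_le cwt]. repeat split; try lia; auto.
    destruct j as [|j]; [exact I |].
    cbn [weight_le cwt]. repeat split; try lia; auto.
Qed.

(** For [i > j + 1] every coefficient involved vanishes, the shifted one included, so the recursion
    survives the guard and holds for all [i]. *)
Lemma dval_opcoef_succ (n j i : nat) (env : coef -> R -> R) (x : R) :
  let L := fun j i => dval env (opcoef n j i) x in
  INR (S j) * L (S j) i =
  dval env (dderiv (opcoef n j i)) x
  + match i with O => 0 | S i1 => L j i1 end
  + (INR n - INR j - 2 * INR n / 3) * env H2 x * L j i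
  + match j with
    | O => 0
    | S j2 =>
      (INR n + 1 - INR j - INR n / 3) * env H1 x * L j2 i
      + match j2 with
        | O => 0
        | S j3 => (INR n + 2 - INR j) * env H0 x * L j3 i
        end
    end.
Proof.
  intros L; unfold L.
  destruct (Nat.lt_ge_cases (S j) i) as [Hi | Hi].
  - destruct i as [|i]; [lia |].
    rewrite !(opcoef_gt n j), (opcoef_gt n (S j)) by lia.
    assert (E : Q2R 0 = 0) by apply RMicromega.Q2R_0.
    destruct j as [|j]; cbn [dval dderiv]; rewrite ?E; [ring |].
    rewrite (opcoef_gt n j) by lia.
    destruct j as [|j]; cbn [dval dderiv]; rewrite ?E; [ring |].
    rewrite (opcoef_gt n j) by lia. cbn [dval dderiv]; rewrite ?E; ring.
  - assert (Hn : forall k, IZR (Z.of_nat k) = INR k)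
      by (intros; symmetry; apply INR_IZR_INZ).
    cbn [opcoef]. rewrite (proj2 (Nat.ltb_ge _ _) Hi).
    cbn [dval Derive_n].
    assert (Ej : INR (S j) * Q2R (1 # Pos.of_succ_nat j) = 1).
    { unfold Q2R; cbn [Qnum Qden].
      change (Z.pos (Pos.of_succ_nat j)) with (Z.of_nat (S j)).
      rewrite Hn. field. apply not_0_INR; lia. }
    rewrite <- Rmult_assoc, Ej, Rmult_1_l.
    assert (E : Q2R 0 = 0) by apply RMicromega.Q2R_0.
    rewrite !Rplus_assoc. f_equal. f_equal.
    { destruct i; [exact E | reflexivity]. }
    f_equal.
    (* The rational constants are written over the denominator 3: [n - j - 2n/3 = (n - 3j)/3], and
       below [n + 1 - j - n/3 = (2n + 3 - 3j)/3]. *)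
    { f_equal. f_equal. unfold Q2R; cbn [Qnum Qden].
      rewrite minus_IZR, mult_IZR, !Hn. field. }
    destruct j as [|j]; [exact E |].
    cbn [dval Derive_n]. f_equal.
    { f_equal. f_equal. unfold Q2R; cbn [Qnum Qden].
      rewrite minus_IZR, plus_IZR, !mult_IZR, !Hn. field. }
    destruct j as [|j]; [exact E |].
    cbn [dval Derive_n]. f_equal. f_equal. unfold Q2R; cbn [Qnum Qden].
    rewrite minus_IZR, plus_IZR, !Hn. field.
Qed.

(** In the recursion at [i = j + 1] only the shifted coefficient, that of [v^(j)] in [u_j],
    survives; hence the leading coefficient [1/j!]. *)
Lemma dval_opcoef_diag (n j : nat) (env : coef -> R -> R) (x : R) :
  INR (fact j) * dval env (opcoef n j j) x = 1.
Proof.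
  assert (E : Q2R 0 = 0) by apply RMicromega.Q2R_0.
  induction j as [|j IH]; [simpl; rewrite RMicromega.Q2R_1; ring |].
  rewrite fact_simpl, mult_INR.
  replace (INR (S j) * INR (fact j) * dval env (opcoef n (S j) (S j)) x)
    with (INR (fact j) * (INR (S j) * dval env (opcoef n (S j) (S j)) x)) by ring.
  rewrite dval_opcoef_succ.
  transitivity (INR (fact j) * dval env (opcoef n j j) x); [| exact IH].
  f_equal.
  rewrite (opcoef_gt n j (S j)) by lia.
  destruct j as [|j]; cbn [dval dderiv]; rewrite ?E; [ring |].
  rewrite (opcoef_gt n j) by lia.
  destruct j as [|j]; cbn [dval dderiv]; rewrite ?E; [ring |].
  rewrite (opcoef_gt n j) by lia. cbn [dval dderiv]; rewrite ?E; ring.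
Qed.

(** * The functions [u_j] and the differential equation *)

(* The formal expression of [u_j = v_(n-j)]. *)
Definition uexpr (n j : nat) : dexpr (option coef) :=
  dsum (fun i => dmul (dmap Some (opcoef n j i)) (dder None i)) j.

Lemma weight_le_uexpr (n j : nat) : weight_le ocwt j (uexpr n j).
Proof.
  apply weight_le_dsum; intros i Hi; simpl; split; [| exact Hi].
  apply weight_le_dmap, weight_le_opcoef.
Qed.

Lemma dval_uexpr (n j : nat) (h0 h1 h2 v : R -> R) (x : R) :
  dval (hvenv h0 h1 h2 v) (uexpr n j) x =
  sum_f_R0 (fun i => dval (henv h0 h1 h2) (opcoef n j i) x * Derive_n v i x) j.
Proof.
  unfold uexpr. rewrite dval_dsum. apply sum_eq; intros i _.
  simpl. now rewrite dval_dmap.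
Qed.

Lemma dval_uexpr_zero (n : nat) (h0 h1 h2 v : R -> R) (x : R) :
  dval (hvenv h0 h1 h2 v) (uexpr n 0) x = v x.
Proof. rewrite dval_uexpr. simpl. rewrite RMicromega.Q2R_1. ring. Qed.

Lemma dval_dderiv_uexpr (n j : nat) (h0 h1 h2 v : R -> R) (x : R) :
  dval (hvenv h0 h1 h2 v) (dderiv (uexpr n j)) x =
  sum_f_R0 (fun i =>
    dval (henv h0 h1 h2) (dderiv (opcoef n j i)) x * Derive_n v i x) j +
  sum_f_R0 (fun i =>
    dval (henv h0 h1 h2) (opcoef n j i) x * Derive_n v (S i) x) j.
Proof.
  unfold uexpr. rewrite dderiv_dsum, dval_dsum, <- sum_plus.
  apply sum_eq; intros i _. simpl. now rewrite dderiv_dmap, !dval_dmap.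
Qed.

(** All sums are padded with zero coefficients to the range [0..j+1]; the coefficients of each
    [v^(i)] are then compared by [dval_opcoef_succ]. *)
Lemma uexpr_recursion (n j : nat) (h0 h1 h2 v : R -> R) (x : R) :
  let u := fun j => dval (hvenv h0 h1 h2 v) (uexpr n j) x in
  INR (S j) * u (S j) =
  dval (hvenv h0 h1 h2 v) (dderiv (uexpr n j)) x
  + (INR n - INR j - 2 * INR n / 3) * h2 x * u j
  + match j with
    | O => 0
    | S j2 =>
      (INR n + 1 - INR j - INR n / 3) * h1 x * u j2
      + match j2 with
        | O => 0
        | S j3 => (INR n + 2 - INR j) * h0 x * u j3
        end
    end.
Proof.
  intros u. set (env := henv h0 h1 h2).
  set (L := fun j i => dval env (opcoef n j i) x).
  assert (E : Q2R 0 = 0) by apply RMicromega.Q2R_0.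
  assert (Hu : forall k, (k <= S j)%nat ->
    sum_f_R0 (fun i => L k i * Derive_n v i x) (S j) = u k).
  { intros k Hk. unfold u. rewrite dval_uexpr. apply sum_f_R0_support; auto.
    intros i Hi. unfold L. rewrite opcoef_gt by lia. simpl. rewrite E. ring. }
  rewrite <- (Hu (S j)), scal_sum, dval_dderiv_uexpr by lia. fold env.
  rewrite <- (sum_f_R0_support
    (fun i => dval env (dderiv (opcoef n j i)) x * Derive_n v i x) j (S j)).
  2: { intros i Hi. rewrite opcoef_gt by lia. simpl. rewrite E. ring. }
  2: lia.
  rewrite <- (sum_f_R0_shift (L j) (fun i => Derive_n v i x)).
  rewrite <- (Hu j) by lia. rewrite scal_sum, <- !sum_plus.
  assert (HL : forall i z, L (S j) i * z * INR (S j) = INR (S j) * L (S j) i * z)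
    by (intros; ring).
  destruct j as [|[|j]].
  - rewrite Rplus_0_r. apply sum_eq; intros i _. rewrite HL.
    unfold L; rewrite dval_opcoef_succ. destruct i; unfold env; simpl henv; ring.
  - rewrite <- (Hu 0%nat) by lia. rewrite Rplus_0_r, scal_sum, <- sum_plus.
    apply sum_eq; intros i _. rewrite HL.
    unfold L; rewrite dval_opcoef_succ. destruct i; unfold env; simpl henv; ring.
  - rewrite <- (Hu (S j)), <- (Hu j) by lia. rewrite !scal_sum, <- !sum_plus.
    apply sum_eq; intros i _. rewrite HL.
    unfold L; rewrite dval_opcoef_succ. destruct i; unfold env; simpl henv; ring.
Qed.

Definition odecoef (n i : nat) : dexpr coef :=
  dmul (dcst (Z.of_nat (fact (S n)) # 1)) (opcoef n (S n) i).

Lemma ode_uexpr_last (n : nat) (h0 h1 h2 v : R -> R) (x : R) :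
  INR (fact (S n)) * dval (hvenv h0 h1 h2 v) (uexpr n (S n)) x =
  Derive_n v (S n) x +
  sum_f_R0 (fun i => dval (henv h0 h1 h2) (odecoef n i) x * Derive_n v i x) n.
Proof.
  rewrite dval_uexpr, tech5, Rmult_plus_distr_l, <- Rmult_assoc.
  rewrite dval_opcoef_diag, scal_sum, Rmult_1_l, Rplus_comm. f_equal.
  apply sum_eq; intros i _. cbn [odecoef dval].
  unfold Q2R; cbn [Qnum Qden]. rewrite <- INR_IZR_INZ. field.
Qed.

(** * The polynomial identity in [y] *)

(* [w 0 = 0] stands for [v_(-1)], and [w (S i)] for [v_i]. *)
Lemma telescoping_sum (n : nat) (w dw : nat -> R) (a0 a1 a2 y : R) :
  w O = 0 -> w (S (S n)) = 0 -> w (S (S (S n))) = 0 ->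
  (forall i, (i <= n)%nat ->
    dw i = (INR n + 1 - INR i) * w i - (INR i + 2) * a0 * w (S (S (S i)))
           - (INR i + 1 - INR n / 3) * a1 * w (S (S i))
           - (INR i - 2 * INR n / 3) * a2 * w (S i)) ->
  sum_f_R0 (fun i => dw i * y ^ i) n * y
  + sum_f_R0 (fun i => w (S i) * (INR i * y ^ pred i)) n
    * (a0 + a1 * y + a2 * y ^ 2 + y ^ 3)
  - INR n / 3 * sum_f_R0 (fun i => w (S i) * y ^ i) n
    * (a1 + 2 * a2 * y + 3 * y ^ 2)
  = a0 * w 2%nat - INR n / 3 * a1 * w 1%nat.
Proof.
  intros W0 W1 W2 H.
  (* Cutting the sums at [m] leaves boundary terms. At [m = n] they vanish: one has the factor
     [n - m], the others contain [w (n+2)] or [w (n+3)]. *)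
  assert (G : forall m, (m <= n)%nat ->
    sum_f_R0 (fun i => dw i * y ^ i) m * y
    + sum_f_R0 (fun i => w (S i) * (INR i * y ^ pred i)) m
      * (a0 + a1 * y + a2 * y ^ 2 + y ^ 3)
    - INR n / 3 * sum_f_R0 (fun i => w (S i) * y ^ i) m
      * (a1 + 2 * a2 * y + 3 * y ^ 2)
    = a0 * w 2%nat - INR n / 3 * a1 * w 1%nat
      - (INR m + 1 - INR n / 3) * a1 * y ^ S m * w (S (S m))
      - (INR m + 1) * y ^ m * a0 * w (S (S m))
      - (INR m + 2) * y ^ S m * a0 * w (S (S (S m)))
      - (INR n - INR m) * w (S m) * y ^ S (S m)).
  { induction m as [|m IH]; intros Hm.
    - simpl. rewrite (H 0%nat), W0 by lia. simpl. field.
    - rewrite !tech5.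
      match goal with
      | |- (?A + ?a) * _ + (?B + ?b) * _ - _ * (?C + ?c) * _ = _ =>
        transitivity ((A * y + B * (a0 + a1 * y + a2 * y ^ 2 + y ^ 3)
          - INR n / 3 * C * (a1 + 2 * a2 * y + 3 * y ^ 2))
          + (a * y + b * (a0 + a1 * y + a2 * y ^ 2 + y ^ 3)
          - INR n / 3 * c * (a1 + 2 * a2 * y + 3 * y ^ 2)));
          [ring |]
      end.
      rewrite IH, (H (S m)) by lia. simpl pred. rewrite !S_INR.
      rewrite <- !tech_pow_Rmult. field. }
  rewrite G, W1, W2 by lia. ring.
Qed.

(** * Regularity of the [v_i] and computation of [M^[n]] *)

Theorem proposition4 (n : nat) (hn : (1 <= n)%nat) :
  { r : nat -> dexpr coef &
  { c : nat -> dexpr (option coef) |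
    (forall i, (i <= n)%nat -> orders_le (horder n) (r i)) /\
    (forall i, (i <= n)%nat -> orders_le (hvorder n) (c i)) /\
    forall (a b : Rbar) (h0 h1 h2 : R -> R),
      class_C1_2d (in_itv a b) Pfield ->
      class_C1_2d (in_itv a b) (Qfield h0 h1 h2) ->
      (forall j, class_C (horder n j) (in_itv a b) (henv h0 h1 h2 j)) ->
      forall v : R -> R,
        lin_ode_solution n (in_itv a b)
          (fun i => dval (henv h0 h1 h2) (r i)) v ->
        let vn := fun i => dval (hvenv h0 h1 h2 v) (c i) in
        (forall x, in_itv a b x -> vn n x = v x) /\
        (forall i, (i <= n)%nat -> class_C 1 (in_itv a b) (vn i)) /\
        exists m : R -> R, forall x y, in_itv a b x ->
          Mfun n Pfield (Qfield h0 h1 h2) (Vpoly n vn) x y = m x } }.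
Proof.
  assert (Hr : forall i, weight_le cwt (S n) (odecoef n i)).
  { intros i. split; [exact I | apply weight_le_opcoef]. }
  exists (odecoef n), (fun i => uexpr n (n - i)). split; [| split].
  (* Weight at most [n + 1] leaves at most [n - 2], [n - 1], [n] derivatives on [h_0], [h_1], [h_2].
     Where [n - 2] truncates, [3 + k <= n + 1] has no solution. *)
  - intros i _. apply weight_le_orders with (2 := Hr i).
    intros [| |] k; simpl; lia.
  - intros i _. apply weight_le_orders with (2 := weight_le_uexpr n (n - i)).
    intros [[| |]|] k; simpl; lia.
  - intros a b h0 h1 h2 _ _ Hh v Hv vn.
    set (env := hvenv h0 h1 h2 v).
    assert (Hder : forall x, in_itv a b x -> forall s k, (ocwt s + k <= n)%nat ->
      ex_derive_n (env s) (S k) x).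
    { intros x Hx [s|] k Hk.
      - apply (Hh s x Hx (S k)). destruct s; simpl in *; lia.
      - apply (Hv x Hx). simpl in Hk; lia. }
    assert (Hcont : forall x, in_itv a b x ->
      forall s k, (ocwt s + k <= S n)%nat -> continuous (Derive_n (env s) k) x).
    { intros x Hx [s|] k Hk.
      - apply (Hh s x Hx k). destruct s; simpl in *; lia.
      - simpl in Hk. apply Nat.le_lteq in Hk. destruct Hk as [Hk | ->].
        + apply (ex_derive_continuous (V := R_NormedModule)).
          apply (proj1 (Hv x Hx) (S k)); lia.
        (* The top derivative [v^(n+1)], which occurs in [v_0'], is only assumed to exist. Its
           continuity comes from the equation, which expresses it through lower derivatives near
           [x]. *)
        + apply continuous_ext_loc with (fun t => - sum_f_R0 (fun i =>
            dval (henv h0 h1 h2) (odecoef n i) t * Derive_n v i t) n).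
          * apply filter_imp with (2 := in_itv_locally a b x Hx).
            intros t Ht. destruct (Hv t Ht) as [_ E]. simpl env. lra.
          * apply (continuous_opp (V := R_NormedModule)), continuous_sum_f_R0.
            intros i Hi. apply (continuous_mult (K := R_AbsRing)).
            -- apply continuous_dval with (2 := Hr i). intros s k Hk.
               apply (Hh s x Hx k). destruct s; simpl in *; lia.
            -- apply (ex_derive_continuous (V := R_NormedModule)).
               apply (proj1 (Hv x Hx) (S i)); lia. }
    assert (Hd : forall i x, in_itv a b x ->
      is_derive (vn i) x (dval env (dderiv (uexpr n (n - i))) x)).
    { intros i x Hx. apply is_derive_dval with ocwt n; [now apply Hder |].
      apply weight_le_mono with (n - i)%nat; [lia | apply weight_le_uexpr]. }
    split; [| split].
    + intros x _. unfold vn. rewrite Nat.sub_diag. apply dval_uexpr_zero.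
    + intros i _ x Hx k Hk.
      assert (Hk' : k = 0%nat \/ k = 1%nat) by lia. destruct Hk' as [-> | ->].
      * split; [exact I |]. apply (ex_derive_continuous (V := R_NormedModule)).
        eexists; now apply Hd.
      * split; [eexists; now apply Hd |].
        apply continuous_ext_loc with (dval env (dderiv (uexpr n (n - i)))).
        -- apply filter_imp with (2 := in_itv_locally a b x Hx).
           intros t Ht. symmetry. now apply is_derive_unique, Hd.
        -- apply continuous_dval with ocwt (S n); [now apply Hcont |].
           apply weight_le_mono with (S (n - i)); [lia |].
           apply weight_le_dderiv, weight_le_uexpr.
    (* The witness is the coefficient of [y^0] in [M^[n]]. *)
    + exists (fun x => h0 x * vn 1%nat x - INR n / 3 * h1 x * vn 0%nat x).
      intros x y Hx.
      set (u := fun j => dval env (uexpr n j) x).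
      (* [vn i] is a junk value for [i > n], because of the truncated [n - i]. *)
      set (w := fun i => match i with
                         | O => 0
                         | S i => if (i <=? n)%nat then u (n - i)%nat else 0
                         end).
      set (dw := fun i => dval env (dderiv (uexpr n (n - i))) x).
      assert (Hw : forall i, (i <= n)%nat -> w (S i) = vn i x).
      { intros i Hi. simpl. now rewrite (proj2 (Nat.leb_le _ _) Hi). }
      assert (Hw0 : forall i, (n < i)%nat -> w (S i) = 0).
      { intros i Hi. simpl. now rewrite (proj2 (Nat.leb_gt _ _) Hi). }
      assert (Hlast : u (S n) = 0).
      { apply Rmult_eq_reg_l with (INR (fact (S n))); [| apply INR_fact_neq_0].
        unfold u, env. rewrite ode_uexpr_last, Rmult_0_r. apply (Hv x Hx). }
      assert (Hdx : Derive (fun t => Vpoly n vn t y) x =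
        sum_f_R0 (fun i => dw i * y ^ i) n).
      { apply is_derive_unique.
        apply (is_derive_sum_f_R0 (fun i t => vn i t * y ^ i)).
        intros i _. apply (is_derive_ext (fun t => scal (vn i t) (y ^ i)));
          [reflexivity |].
        apply (is_derive_scal_l (V := R_NormedModule)), Hd, Hx. }
      assert (Hdy : Derive (fun t => Vpoly n vn x t) y =
        sum_f_R0 (fun i => w (S i) * (INR i * y ^ pred i)) n).
      { apply is_derive_unique.
        apply (is_derive_sum_f_R0 (fun i t => vn i x * t ^ i)).
        intros i Hi. rewrite Hw by exact Hi.
        auto_derive; [exact I | ring]. }
      assert (HV : Vpoly n vn x y = sum_f_R0 (fun i => w (S i) * y ^ i) n).
      { apply sum_eq; intros i Hi. now rewrite Hw. }
      assert (Hdiv : divergence Pfield (Qfield h0 h1 h2) x y =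
        h1 x + 2 * h2 x * y + 3 * y ^ 2).
      { unfold divergence, Pfield, Qfield. rewrite Derive_const, Rplus_0_l.
        apply is_derive_unique. auto_derive; [exact I | ring]. }
      unfold Mfun, grad, dot; cbn [fst snd].
      rewrite Hdx, Hdy, HV, Hdiv. unfold Pfield, Qfield.
      (* The index 1 is in range because [n >= 1]. *)
      rewrite <- (Hw 0%nat), <- (Hw 1%nat) by lia.
      apply telescoping_sum; [reflexivity | apply Hw0; lia | apply Hw0; lia |].
      intros i Hi.
      assert (Hrec := uexpr_recursion n (n - i) h0 h1 h2 v x).
      fold env in Hrec. cbv beta zeta in Hrec.
      change (dval env (dderiv (uexpr n (n - i))) x) with (dw i) in Hrec.
      (* For [i = 0] the left side contains [u_(n+1)], which the differential equation makes zero,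
         in agreement with [w 0 = 0]; otherwise this is a reindexing. *)
      assert (E0 : INR (S (n - i)) * u (S (n - i)) = (INR n + 1 - INR i) * w i).
      { rewrite S_INR, minus_INR by exact Hi. destruct i as [|i].
        - rewrite Nat.sub_0_r, Hlast. simpl. ring.
        - simpl w. rewrite (proj2 (Nat.leb_le i n)) by lia.
          replace (S (n - S i)) with (n - i)%nat by lia. rewrite S_INR. ring. }
      unfold u in E0. rewrite E0 in Hrec.
      rewrite minus_INR in Hrec by exact Hi.
      change (dval env (uexpr n (n - i)) x) with (vn i x) in Hrec.
      rewrite <- Hw in Hrec by exact Hi.
      (* The recursion has fewer terms for [j = 0] and [j = 1]; the missing ones correspond to
         values of [w] beyond [n + 1], which are zero. *)
      destruct (n - i)%nat as [|[|j]] eqn:Ej.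
      * rewrite (Hw0 (S (S i))), (Hw0 (S i)) by lia. lra.
      * rewrite (Hw0 (S (S i))) by lia.
        rewrite (Hw (S i)) by lia. unfold vn at 1.
        replace (n - S i)%nat with 0%nat by lia. fold env. lra.
      * rewrite (Hw (S i)), (Hw (S (S i))) by lia. unfold vn.
        replace (n - S i)%nat with (S j) by lia.
        replace (n - S (S i))%nat with j by lia. fold env. lra.
Qed.
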